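(* Let $A_i(\varepsilon)=A_i+\varepsilon\Delta^{(i)}\in\mathbb C^{d\times d}$, $i=1,\dots,m$, $\varepsilon\in\mathbb R$, with $\|\Delta^{(i)}\|_F=1$ and each $A_i$ having simple nonzero eigenvalues $\lambda_1^{(i)},\dots,\lambda_d^{(i)}$, and let $p_1,\dots,p_m$ be probability weights. Assume simultaneous triangularizability: there exist $\varepsilon_0>0$ and invertible matrices $S(\varepsilon)$, $|\varepsilon|\le\varepsilon_0$, such that $T_i(\varepsilon):=S(\varepsilon)^{-1}A_i(\varepsilon)S(\varepsilon)$ is upper triangular for all $i$, with diagonal entries $\lambda_j^{(i)}(\varepsilon):=(T_i(\varepsilon))_{jj}\ne0$, ordered so that $\lambda_j^{(i)}(0)=\lambda_j^{(i)}$ and labelled so as to agree with the analytic eigenvalue branches of $A_i(\varepsilon)$ issuing from $\lambda_j^{(i)}$. Let $\mu_j(\varepsilon):=\sum_ip_i\log|\lambda_j^{(i)}(\varepsilon)|$ and $\rho_\infty(\varepsilon):=\max_{1\le j\le d}e^{\mu_j(\varepsilon)}$. Assume there is an index $j^\star$ with $\mu_{j^\star}(0)>\max_{j\ne j^\star}\mu_j(0)$. Then, for $|\varepsilon|$ sufficiently small, $$\log\rho_\infty(\varepsilon)=\sum_{i=1}^m p_i\log|\lambda_{j^\star}^{(i)}(\varepsilon)|=\log\rho_\infty(0)+\varepsilon\sum_{i=1}^m p_i\,\Re\Bigl(\frac{a_{i,j^\star}}{\lambda_{j^\star}^{(i)}(0)}\Bigr)+O(\varepsilon^2),$$ where $a_{i,j^\star}:=u_{i,j^\star}^*\Delta^{(i)}v_{i,j^\star}$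 and $u_{i,j^\star},v_{i,j^\star}$ are left and right eigenvectors of $A_i$ associated with $\lambda_{j^\star}^{(i)}(0)$, normalized by $u_{i,j^\star}^*v_{i,j^\star}=1$. Equivalently, $$\rho_\infty(\varepsilon)=\rho_\infty(0)\exp\Bigl(\varepsilon\sum_{i=1}^m p_i\,\Re\Bigl(\frac{a_{i,j^\star}}{\lambda_{j^\star}^{(i)}(0)}\Bigr)+O(\varepsilon^2)\Bigr).$$ If the $A_i$ are diagonal, $A_i=\operatorname{diag}(\lambda_1^{(i)},\dots,\lambda_d^{(i)})$ (so $u_{i,j^\star}=v_{i,j^\star}=e_{j^\star}$), this reduces to $$\log\rho_\infty(\varepsilon)=\log\rho_\infty(0)+\varepsilon\sum_{i=1}^m p_i\,\Re\Bigl(\frac{\Delta^{(i)}_{j^\star j^\star}}{\lambda_{j^\star}^{(i)}}\Bigr)+O(\varepsilon^2).$$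
   Context: $p_i\ge0$, $\sum_ip_i=1$. A left eigenvector $u$ of $A$ for the eigenvalue $\lambda$ satisfies $u^*A=\lambda u^*$. $\|\cdot\|_F$ is the Frobenius norm. $O(\varepsilon^2)$ is as $\varepsilon\to0$ for the fixed family. *)

(* Defs.v *)
(* The complex numbers are R[i] over R : realType; normc is their R-valued
   modulus, whereas `|z| is the modulus seen as an element of R[i]. *)
From mathcomp Require Export all_boot all_order all_algebra.
From mathcomp Require Export all_classical all_reals all_analysis.
From mathcomp Require Export complex.

Set Implicit Arguments.
Unset Strict Implicit.
Unset Printing Implicit Defensive.

Import Order.TTheory GRing.Theory Num.Theory.
Import numFieldNormedType.Exports.
Import Normc.

Local Open Scope classical_set_scope.
Local Open Scope ring_scope.
Local Open Scope complex_scope.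
Local Open Scope sesquilinear_scope.

Section Definitions.
Variable R : realType.

Section Matrices.
Variable d : nat.
Implicit Types (M S : 'M[R[i]]_d) (u v : 'cV[R[i]]_d).

Definition frobenius_norm M : R :=
  Num.sqrt (\sum_(k < d) \sum_(l < d) normc (M k l) ^+ 2).

(* [is_trig_mx] of the library means lower triangular. *)
Definition upper_triangular M : Prop :=
  forall k l : 'I_d, (l < k)%N -> M k l = 0.

(* The d eigenvalues of M, counted with algebraic multiplicity, are the values
   of lam, and they are pairwise distinct. *)
Definition simple_eigenvalues M (lam : 'I_d -> R[i]) : Prop :=
  char_poly M = \prod_(j < d) ('X - (lam j)%:P) /\ injective lam.

(* Left eigenvectors are column vectors acting through their conjugate
   transpose; the normalization forces u and v to be nonzero. *)
Definition normalized_eigenvectors M (a : R[i]) u v : Prop :=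
  [/\ u^t* *m M = a *: u^t*, M *m v = a *: v & u^t* *m v = 1%:M].

End Matrices.

(* R[i]^o is R[i] with its usual topology, given by the modulus. *)
Definition analytic_at0 (b : R -> R[i]) : Prop :=
  exists c : nat -> R[i], \forall t \near (0 : R),
    (series (fun n => c n * t%:C ^+ n) : nat -> R[i]^o) @ \oo
      --> (b t : R[i]^o).

Definition analytic_eigenvalue_branch (d : nat) (M : R -> 'M[R[i]]_d)
    (a : R[i]) (b : R -> R[i]) : Prop :=
  [/\ b 0 = a, analytic_at0 b & \forall t \near (0 : R), eigenvalue (M t) (b t)].

Section Family.
Variables d m : nat.

Definition perturbed (A Delta : 'I_m -> 'M[R[i]]_d) (i : 'I_m) (eps : R) :
    'M[R[i]]_d :=
  A i + eps%:C *: Delta i.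

Definition triangular_form (A Delta : 'I_m -> 'M[R[i]]_d)
    (S : R -> 'M[R[i]]_d) (i : 'I_m) (eps : R) : 'M[R[i]]_d :=
  invmx (S eps) *m perturbed A Delta i eps *m S eps.

Definition diag_entry (A Delta : 'I_m -> 'M[R[i]]_d) (S : R -> 'M[R[i]]_d)
    (i : 'I_m) (j : 'I_d) (eps : R) : R[i] :=
  triangular_form A Delta S i eps j j.

Definition mu (p : 'I_m -> R) (l : 'I_m -> 'I_d -> R -> R[i]) (j : 'I_d)
    (eps : R) : R :=
  \sum_(i < m) p i * ln (normc (l i j eps)).

(* The default value 0 of the maximum is irrelevant when 0 < d, since the
   exponentials are positive. *)
Definition rho_infty (p : 'I_m -> R) (l : 'I_m -> 'I_d -> R -> R[i])
    (eps : R) : R :=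
  \big[Num.max/0]_(j < d) expR (mu p l j eps).

Definition first_order_coef (p : 'I_m -> R) (a lam : 'I_m -> R[i]) : R :=
  \sum_(i < m) p i * complex.Re (a i / lam i).

End Family.
End Definitions.

(* Main.v *)
(* Near 0 the index jstar stays dominant, so log rho is the weighted sum of
   log |b_i|, where b_i is the analytic branch of A_i(eps) through the dominant
   eigenvalue.  A branch satisfies b(t) = lam + t c + O(t^2), hence
   log |b(t)| = log |lam| + t Re(c / lam) + O(t^2), and only c = u^* Delta v
   remains to be shown.  As lam is simple, G = A - lam + v u^* is invertible and
   Q = G^-1 satisfies (A - lam) Q = 1 - v u^*.  If A - lam + B is singular, with
   B = t (Delta - (b(t) - lam) / t), then u^* adj(1 + B Q) B v = 0 for small t;
   dividing by t and letting t tend to 0 gives u^* (Delta - c) v = 0. *)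
Require Import Defs.
From mathcomp Require Import ring lra.

Set Implicit Arguments.
Unset Strict Implicit.
Unset Printing Implicit Defensive.

Import Order.TTheory GRing.Theory Num.Theory.
Import numFieldNormedType.Exports.
Import Normc.

Local Open Scope classical_set_scope.
Local Open Scope ring_scope.
Local Open Scope complex_scope.
Local Open Scope sesquilinear_scope.

(** * The real-valued modulus on [R[i]] *)

Section ComplexModulus.
Variable R : realType.
Implicit Types (z : R[i]) (t : R).

Lemma normr_normc z : `|z| = (normc z)%:C.
Proof. by case: z. Qed.

Lemma normc_ge0 z : 0 <= normc z.
Proof. by rewrite -lecR -normr_normc; exact: normr_ge0. Qed.

Lemma normc_real t : normc t%:C = `|t|.
Proof. by rewrite /normc /= expr0n addr0 sqrtr_sqr. Qed.

Lemma normc_gt0 z : (0 < normc z) = (z != 0).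
Proof. by rewrite -ltcR -normr_normc; exact: normr_gt0. Qed.

Lemma normc_le0 z : normc z <= 0 -> z = 0.
Proof.
by move=> z_le0; apply: eq0_normc; apply/eqP; rewrite eq_le z_le0 normc_ge0.
Qed.

Lemma sqr_normcE z : normc z ^+ 2 = complex.Re z ^+ 2 + complex.Im z ^+ 2.
Proof. by case: z => x y; rewrite sqr_sqrtr // addr_ge0 ?sqr_ge0. Qed.

Lemma Re_le_normc z : `|complex.Re z| <= normc z.
Proof. by rewrite -lecR -normr_normc normc_ge_Re. Qed.

Lemma Re_mul_real t z : complex.Re (t%:C * z) = t * complex.Re z.
Proof. by case: z => x y /=; rewrite mul0r subr0. Qed.

(** Closed discs are closed. It will carry a bound on the partial sums of a power series over to its
    sum. *)
Lemma normc_le_limit (w : nat -> R[i]) (l a : R[i]) (r : R) :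
    w @ \oo --> (l : R[i]^o) -> (\forall n \near \oo, normc (w n - a) <= r) ->
  normc (l - a) <= r.
Proof.
move=> wl wr; apply/ler_addgt0Pr => e e0.
have /cvgrPdist_lt/(_ e%:C) : (w : nat -> R[i]^o) @ \oo --> (l : R[i]^o) by [].
rewrite ltcR => /(_ e0) we.
have [n [le_r lt_e]] : exists n, normc (w n - a) <= r /\ `|l - w n| < e%:C.
  by near \oo => n; exists n; split; near: n.
rewrite normr_normc ltcR in lt_e.
rewrite -(subrK (w n) l) -addrA addrC.
by rewrite (le_trans (le_normcD _ _)) // lerD // ltW.
Unshelve. all: by end_near.
Qed.

End ComplexModulus.

(** * Analytic functions and the logarithm of their modulus to first order *)

Section FirstOrderExpansion.
Variable R : realType.
Implicit Types (t : R).

Lemma near_norm_le (e : R) : 0 < e -> \forall t \near (0 : R), `|t| <= e.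
Proof. exact: (@nbhs0_le R R). Qed.

(** With x = |t| / t0 <= 1/2 the k-th term is at most M x^k, and a geometric tail starting at x^2
    sums to at most 2 x^2. *)
Lemma power_series_tail (c : nat -> R[i]) (t0 M t : R) (n : nat) :
    0 < t0 -> (forall k, normc (c k * t0%:C ^+ k) <= M) -> `|t| <= t0 / 2 ->
  normc (series (fun k => c k * t%:C ^+ k) n.+2 - (c 0 + t%:C * c 1)) <=
    2 * M * (`|t| / t0) ^+ 2.
Proof.
move=> t0_gt0 cM tt0; set x := `|t| / t0.
have M_ge0 : 0 <= M := le_trans (normc_ge0 _) (cM 0%N).
have x_ge0 : 0 <= x by rewrite divr_ge0 // ltW.
have x_le : x <= 2^-1 by rewrite ler_pdivrMr // mulrC.
have cx k : normc (c k * t%:C ^+ k) <= M * x ^+ k.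
  have -> : c k * t%:C ^+ k = c k * t0%:C ^+ k * ((t / t0) ^+ k)%:C.
    rewrite -mulrA -!rmorphXn -rmorphM -exprMn [t0 * _]mulrC.
    by rewrite divfK ?gt_eqF.
  rewrite normcM normc_real normrX normrM normfV (gtr0_norm t0_gt0) -/x.
  by rewrite ler_wpM2r // exprn_ge0.
(* The subtracted power makes the bound inductive: the next term costs M x^(n+2), which fits because
   2 x^(n+3) <= x^(n+2). *)
suff : normc (series (fun k => c k * t%:C ^+ k) n.+2 - (c 0 + t%:C * c 1)) <=
    2 * M * (x ^+ 2 - x ^+ n.+2).
  by move/le_trans; apply; rewrite ler_wpM2l ?mulr_ge0 // gerBl exprn_ge0.
elim: n => [|n IHn].
  rewrite /series /= !big_nat_recr //= big_nil add0r expr0 expr1 mulr1.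
  by rewrite [c 1 * _]mulrC !subrr normc0 mulr0.
rewrite /series /= big_nat_recr //= addrAC.
apply: le_trans (le_normcD _ _) _.
apply: le_trans (lerD IHn (cx _)) _.
have xn_ge0 : 0 <= x ^+ n.+2 by rewrite exprn_ge0.
have : M * (x ^+ n.+2 * x) <= M * (x ^+ n.+2 * 2^-1).
  by rewrite !ler_wpM2l.
by rewrite [x ^+ n.+3]exprSr; lra.
Qed.

(** The constant is kept explicit, rather than hidden in a Landau symbol, so that later estimates
    reduce to real arithmetic. *)
Definition first_order_at0 (b : R -> R[i]) (c1 : R[i]) : Prop :=
  exists2 C : R, 0 <= C &
    \forall t \near (0 : R), normc (b t - (b 0 + t%:C * c1)) <= C * t ^+ 2.

Definition real_first_order_at0 (f : R -> R) (s : R) : Prop :=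
  exists2 C : R, 0 <= C &
    \forall t \near (0 : R), `|f t - (f 0 + t * s)| <= C * t ^+ 2.

(** Convergence at a single t0 > 0 makes the terms there bounded, and this controls the tail for |t|
    <= t0 / 2. *)
Lemma analytic_first_order (b : R -> R[i]) :
  analytic_at0 b -> exists c1, first_order_at0 b c1.
Proof.
move=> [c b_series]; have /nbhs_ballP[e /= e_gt0 ball_b] := b_series.
pose t0 := e / 2; have t0_gt0 : 0 < t0 by rewrite divr_gt0.
have [M cM] : exists M, forall k, normc (c k * t0%:C ^+ k) <= M.
  have t0_ball : ball (0 : R) e t0.
    by rewrite /ball /= sub0r normrN gtr0_norm // ltr_pdivrMr // ltr_pMr // ltr1n.
  have /cvg_ex/cvg_series_cvg_0 c0 : exists l : R[i]^o,
      (series (fun n => c n * t0%:C ^+ n) : nat -> R[i]^o) @ \oo --> l.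
    by exists (b t0); exact: ball_b.
  have /cvg_seq_bounded : cvgn (fun n => c n * t0%:C ^+ n : R[i]^o).
    by apply/cvg_ex; exists 0.
  (* The bound lives in [R[i]], where the order compares real parts and requires equal imaginary
     parts; its real part is therefore a bound in [R]. *)
  move=> /pinfty_ex_gt0[M _ cM]; exists (complex.Re M) => k.
  have : `|c k * t0%:C ^+ k| <= M := cM k I.
  rewrite normr_normc.
  by case: (M) => x y; rewrite lecE => /andP[].
have M_ge0 : 0 <= M := le_trans (normc_ge0 _) (cM 0%N).
pose C := 2 * M / t0 ^+ 2.
have C_ge0 : 0 <= C by apply: divr_ge0; [exact: mulr_ge0 | exact: sqr_ge0].
have bound : \forall t \near (0 : R),
    normc (b t - (c 0 + t%:C * c 1)) <= C * t ^+ 2.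
  near=> t; have tt0 : `|t| <= t0 / 2.
    by near: t; apply: near_norm_le; rewrite divr_gt0.
  have t_series : (series (fun n => c n * t%:C ^+ n) : nat -> R[i]^o) @ \oo
      --> (b t : R[i]^o) by near: t.
  apply: normc_le_limit t_series _; exists 2%N => // -[|[|n]] // _.
  apply: le_trans (power_series_tail n t0_gt0 cM tt0) _.
  by rewrite expr_div_n real_normK ?num_real // mulrA mulrAC.
(* At t = 0 the bound says that the modulus of b 0 - c 0 is at most 0. *)
have b0 : c 0 = b 0.
  have /= := nbhs_singleton bound.
  rewrite mul0r addr0 expr0n mulr0 => /normc_le0/eqP.
  by rewrite subr_eq0 => /eqP.
by exists (c 1%N), C => //; rewrite -b0.
Unshelve. all: by end_near.
Qed.

(** Both sides come from ln (1 + y) <= y, taken at y = x and, since 1 / (1 + x) = 1 - x / (1 + x),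
    at y = - x / (1 + x). The gap between the two bounds is x^2 / (1 + x) <= 2 x^2. *)
Lemma ln1D_quadratic (x : R) : `|x| <= 2^-1 -> `|ln (1 + x) - x| <= 2 * x ^+ 2.
Proof.
rewrite ler_norml => /andP[x_ge x_le].
have x1_gt0 : 0 < 1 + x by lra.
have ln_le : ln (1 + x) <= x by apply: le_ln1Dx; lra.
have x1_unit : 1 + x != 0 by rewrite gt_eqF.
have ln_ge : x / (1 + x) <= ln (1 + x).
  rewrite -[ln _]opprK -lnV ?posrE // lerNr.
  have {1}-> : (1 + x)^-1 = 1 + - (x / (1 + x)) by field.
  apply: le_ln1Dx; rewrite ltrN2 ltr_pdivrMr //; lra.
have x1V : (1 + x)^-1 <= 2.
  by rewrite -[2]invrK lef_pV2 ?posrE ?invr_gt0 //; lra.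
have : x ^+ 2 * (1 + x)^-1 <= x ^+ 2 * 2 by rewrite ler_wpM2l ?sqr_ge0.
have -> : x ^+ 2 * (1 + x)^-1 = x - x / (1 + x) by field.
have := sqr_ge0 x.
by rewrite ler_norml => ? ?; apply/andP; split; lra.
Qed.

(** No complex logarithm is used: writing b t = b 0 (1 + zeta), one has 2 ln |1 + zeta| = ln (1 + x)
    with the real number x = 2 Re zeta + |zeta|^2 = 2 t Re z + O(t^2). *)
Lemma ln_normc_first_order (b : R -> R[i]) (c1 : R[i]) :
    b 0 != 0 -> first_order_at0 b c1 ->
  real_first_order_at0 (fun t => ln (normc (b t))) (complex.Re (c1 / b 0)).
Proof.
move=> b0_neq0 [C0 C0_ge0 bC0]; set z := c1 / b 0.
have nb0_gt0 : 0 < normc (b 0) by rewrite normc_gt0.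
(* For small t these constants give |w| <= C1 t^2, |zeta| <= K |t| and |x| <= L |t|. *)
pose C1 := C0 / normc (b 0); pose K := normc z + C1.
pose L := 2 * normc z + 2 * C1 + K ^+ 2.
have C1_ge0 : 0 <= C1 by rewrite divr_ge0 // ltW.
have nz_ge0 := normc_ge0 z.
have K_ge0 : 0 <= K by rewrite addr_ge0.
have K2_ge0 : 0 <= K ^+ 2 by rewrite sqr_ge0.
have L_ge0 : 0 <= L by rewrite /L; lra.
have L2_ge0 : 0 <= L ^+ 2 by rewrite sqr_ge0.
(* Half of the error (2 C1 + K^2) t^2 in x, plus half of the logarithm error 2 x^2 <= 2 L^2 t^2. *)
exists (C1 + K ^+ 2 / 2 + L ^+ 2); first by lra.
near=> t.
have t_small : `|t| <= (2 * (L + 1))^-1.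
  by near: t; apply: near_norm_le; rewrite invr_gt0 mulr_gt0 // ltr_wpDl.
have t_le1 : `|t| <= 1 by near: t; apply: near_norm_le.
have t_ge0 := normr_ge0 t.
have t2E : `|t| ^+ 2 = t ^+ 2 by rewrite real_normK ?num_real.
have t2_ge0 := sqr_ge0 t.
have t2_le : t ^+ 2 <= `|t| by rewrite -t2E expr2 ler_piMl.
pose w := (b t - (b 0 + t%:C * c1)) / b 0.
have wE : b t = b 0 * (1 + (t%:C * z + w)).
  by rewrite /w /z; field.
have w_le : normc w <= C1 * t ^+ 2.
  rewrite normcM normcV /C1 mulrAC ler_pM2r ?invr_gt0 //.
  by near: t.
set zeta := t%:C * z + w in wE *.
have zeta_le : normc zeta <= K * `|t|.
  apply: le_trans (le_normcD _ _) _; rewrite normcM normc_real.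
  have : C1 * t ^+ 2 <= C1 * `|t| by rewrite ler_wpM2l.
  by rewrite /K; lra.
have zeta2_le : normc zeta ^+ 2 <= K ^+ 2 * t ^+ 2.
  by rewrite -t2E -exprMn ler_pXn2r ?nnegrE ?normc_ge0 ?mulr_ge0.
pose x := 2 * complex.Re zeta + normc zeta ^+ 2.
have normE : normc (1 + zeta) ^+ 2 = 1 + x.
  by rewrite /x !sqr_normcE; case: zeta {wE zeta_le zeta2_le x} => ? ? /=; ring.
have Re_zeta : complex.Re zeta = t * complex.Re z + complex.Re w.
  by rewrite raddfD /= Re_mul_real.
have Re_w : `|complex.Re w| <= C1 * t ^+ 2 := le_trans (Re_le_normc w) w_le.
have x_lin : `|x - 2 * (t * complex.Re z)| <= (2 * C1 + K ^+ 2) * t ^+ 2.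
  move: Re_w; rewrite !ler_norml => /andP[? ?].
  have := sqr_ge0 (normc zeta).
  by rewrite /x Re_zeta => ?; apply/andP; split; lra.
have tRe : `|t * complex.Re z| <= normc z * `|t|.
  by rewrite normrM mulrC ler_wpM2r // Re_le_normc.
have x_le : `|x| <= L * `|t|.
  have : (2 * C1 + K ^+ 2) * t ^+ 2 <= (2 * C1 + K ^+ 2) * `|t|.
    by rewrite ler_wpM2l //; lra.
  move: x_lin tRe; rewrite !ler_norml /L => /andP[? ?] /andP[? ?] ?.
  by apply/andP; split; lra.
have x_half : `|x| <= 2^-1.
  apply: (le_trans x_le); have : (L + 1) * `|t| <= 2^-1.
    move: t_small; rewrite invfM ler_pdivlMr; last by lra.
    by rewrite mulrC.
  by lra.
have x2_le : x ^+ 2 <= L ^+ 2 * t ^+ 2.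
  rewrite -t2E -exprMn -[x ^+ 2]real_normK ?num_real //.
  by rewrite ler_pXn2r ?nnegrE ?mulr_ge0.
have x1_gt0 : 0 < 1 + x by move: x_half; rewrite ler_norml => /andP[]; lra.
have n1_gt0 : 0 < normc (1 + zeta).
  rewrite lt_def normc_ge0 andbT; apply: contraTneq x1_gt0 => n0.
  by rewrite -normE n0 expr0n ltxx.
have lnE : ln (1 + x) = 2 * ln (normc (1 + zeta)).
  by rewrite -normE lnXn // mulr_natl.
rewrite wE normcM lnM ?posrE //.
have := ln1D_quadratic x_half; rewrite lnE.
move: x_lin; rewrite !ler_norml => /andP[? ?] /andP[? ?].
by apply/andP; split; lra.
Unshelve. all: by end_near.
Qed.

End FirstOrderExpansion.

(** * Linear algebra around a simple eigenvalue *)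

Section SimpleEigenvalues.
Variables (F : fieldType) (d : nat) (A : 'M[F]_d) (lam : 'I_d -> F).
Hypotheses (lam_inj : injective lam) (lam_eig : forall j, eigenvalue A (lam j)).

(** The d eigenspaces are nonzero and in direct sum inside a space of dimension d, which leaves no
    room for a second dimension in any of them. *)
Lemma mxrank_eigenspace_le1 (j : 'I_d) : (\rank (eigenspace A (lam j)) <= 1)%N.
Proof.
have rank_ge1 k : (1 <= \rank (eigenspace A (lam k)))%N.
  by rewrite lt0n mxrank_eq0; exact: lam_eig.
have /mxdirectP /= sum_rank :
    mxdirect (\sum_(k | true) eigenspace A (lam k)).
  by apply: mxdirect_sum_eigenspace => k l _ _; exact: lam_inj.
have sum_le : (\sum_(k < d) \rank (eigenspace A (lam k)) <= d)%N.
  by rewrite -sum_rank rank_leq_col.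
have rest_ge : (d.-1 <= \sum_(k < d | k != j) \rank (eigenspace A (lam k)))%N.
  rewrite -[d in d.-1]card_ord (cardD1 j) inE /= -sum1_card.
  rewrite (eq_bigl (fun k => k != j)) => [|k]; last by rewrite !inE andbT.
  exact: leq_sum.
move: sum_le; rewrite (bigD1 j) //= => sum_le.
have := leq_trans (leq_add (leqnn _) rest_ge) sum_le.
by rewrite -[X in (_ <= X)%N](@prednK d) ?(leq_ltn_trans (leq0n j)) //
  -add1n leq_add2r.
Qed.

Variables (j : 'I_d) (u : 'rV[F]_d) (v : 'cV[F]_d).
Hypotheses (uA : u *m A = lam j *: u) (Av : A *m v = lam j *: v)
  (uv : u *m v = 1%:M).

Let N := A - (lam j)%:M.

Lemma shifted_mulr : N *m v = 0.
Proof. by rewrite mulmxBl Av mul_scalar_mx subrr. Qed.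

Lemma shifted_mull : u *m N = 0.
Proof. by rewrite mulmxBr uA mul_mx_scalar subrr. Qed.

(** Multiplying w (N + v u) = 0 by v on the right gives w v = 0, hence w N = 0. So w is a multiple a
    u of u, and a = w v = 0. *)
Lemma rank_one_update_unit : N + v *m u \in unitmx.
Proof.
have u_neq0 : u != 0.
  by apply: contra_eq_neq uv => ->; rewrite mul0mx eq_sym oner_eq0.
have u_eig : (u <= eigenspace A (lam j))%MS by apply/eigenspaceP.
rewrite -row_free_unit -kermx_eq0; apply/rowV0P => w /sub_kermxP.
rewrite mulmxDr mulmxA => wN.
have wv0 : w *m v = 0.
  have /(congr1 (mulmx^~ v)) := wN.
  by rewrite mul0mx mulmxDl -!mulmxA shifted_mulr mulmx0 add0r uv mulmx1.
have w_eig : (w <= eigenspace A (lam j))%MS.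
  apply/eigenspaceP; apply/eqP; rewrite -subr_eq0 -mul_mx_scalar -mulmxBr.
  by move: wN; rewrite wv0 mul0mx addr0 => ->.
have eig_u : (eigenspace A (lam j) <= u)%MS.
  rewrite -(geq_leqif (mxrank_leqif_sup u_eig)) rank_rV u_neq0.
  exact: mxrank_eigenspace_le1.
have /sub_rVP[a wE] := submx_trans w_eig eig_u.
move: wv0; rewrite wE -scalemxAl uv => /eqP.
by rewrite scaler_eq0 oner_eq0 orbF => /eqP ->; rewrite scale0r.
Qed.

Let Q := invmx (N + v *m u).

(** The row u is fixed by N + v u, hence by its inverse Q, so v u Q = v u. *)
Lemma shifted_invmx : N *m Q = 1%:M - v *m u.
Proof.
have uG : u *m (N + v *m u) = u.
  by rewrite mulmxDr shifted_mull add0r mulmxA uv mul1mx.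
have uQ : u *m Q = u by rewrite -{1}uG mulmxK ?rank_one_update_unit.
rewrite -[X in v *m X]uQ mulmxA -(mulmxV rank_one_update_unit) -/Q -mulmxBl.
by rewrite addrK.
Qed.

(* If w is a left null vector of N + B then w (1 + B Q) = (w v) u, while
   w B v = 0; eliminating w gives the claim. *)
Lemma perturbed_kernel_adj (B : 'M[F]_d) :
  ~~ row_free (N + B) -> \det (1%:M + B *m Q) != 0 ->
  u *m \adj (1%:M + B *m Q) *m B *m v = 0.
Proof.
rewrite -kermx_eq0 => /rowV0Pn[w /sub_kermxP]; rewrite mulmxDr => wNB w_neq0.
set P := 1%:M + B *m Q => detP.
have wB : w *m B = - (w *m N) by apply/eqP; rewrite eq_sym eqr_oppLR -addr_eq0 wNB.
have wP : w *m P = w *m v *m u.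
  rewrite mulmxDr mulmx1 mulmxA wB mulNmx -(mulmxA w N) shifted_invmx mulmxBr mulmx1.
  by rewrite [w *m (v *m u)]mulmxA opprB addrC subrK.
have wBv : w *m B *m v = 0 by rewrite wB mulNmx -mulmxA shifted_mulr mulmx0 oppr0.
have wadj : w *m v *m u *m \adj P = \det P *: w.
  by rewrite -wP -mulmxA mul_mx_adj mul_mx_scalar.
have wv_neq0 : (w *m v) 0 0 != 0.
  apply: contraNneq w_neq0 => wv0; move: wadj.
  rewrite [w *m v]mx11_scalar wv0 mul_scalar_mx scale0r mul0mx => /esym/eqP.
  by rewrite scaler_eq0 (negPf detP).
have : (w *m v) 0 0 *: (u *m \adj P *m B *m v) = 0.
  rewrite -mul_scalar_mx -mx11_scalar !mulmxA wadj -!scalemxAl wBv.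
  by rewrite scaler0.
by move/eqP; rewrite scaler_eq0 (negPf wv_neq0) => /eqP.
Qed.

End SimpleEigenvalues.

(** * Entrywise limits of matrices *)

Section EntrywiseConvergence.
Variables (K : numFieldType) (T : Type) (F : set_system T).
Context {FF : Filter F}.

(** Working entry by entry suits the determinant and the adjugate, which are polynomial in the
    entries. *)
Definition cvg_entries m n (M : T -> 'M[K]_(m, n)) (M0 : 'M[K]_(m, n)) : Prop :=
  forall k l, M x k l @[x --> F] --> M0 k l.

Lemma cvg_entries_cst m n (M0 : 'M[K]_(m, n)) : cvg_entries (fun=> M0) M0.
Proof. by move=> k l; exact: cvg_cst. Qed.

Lemma cvg_entriesD m n (M N : T -> 'M[K]_(m, n)) M0 N0 :
  cvg_entries M M0 -> cvg_entries N N0 ->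
  cvg_entries (fun x => M x + N x) (M0 + N0).
Proof.
move=> MM0 NN0 k l; rewrite mxE; under eq_fun do rewrite mxE.
exact: cvgD (MM0 k l) (NN0 k l).
Qed.

Lemma cvg_entriesZ m n (a : T -> K) (a0 : K) (M : T -> 'M[K]_(m, n)) M0 :
  a x @[x --> F] --> a0 -> cvg_entries M M0 ->
  cvg_entries (fun x => a x *: M x) (a0 *: M0).
Proof.
move=> aa0 MM0 k l; rewrite mxE; under eq_fun do rewrite mxE.
exact: cvgM aa0 (MM0 k l).
Qed.

Lemma cvg_entriesM m n p (M : T -> 'M[K]_(m, n)) (N : T -> 'M[K]_(n, p)) M0 N0 :
  cvg_entries M M0 -> cvg_entries N N0 ->
  cvg_entries (fun x => M x *m N x) (M0 *m N0).
Proof.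
move=> MM0 NN0 k l; rewrite mxE; under eq_fun do rewrite mxE.
apply: cvg_big => [|h _]; first exact: add_continuous.
exact: cvgM (MM0 k h) (NN0 h l).
Qed.

Lemma cvg_det n (M : T -> 'M[K]_n) M0 :
  cvg_entries M M0 -> \det (M x) @[x --> F] --> \det M0.
Proof.
move=> MM0; apply: cvg_big => [|s _]; first exact: add_continuous.
apply: cvgM; first exact: cvg_cst.
apply: cvg_big => [|k _]; first exact: mul_continuous.
exact: MM0.
Qed.

Lemma cvg_entries_adj n (M : T -> 'M[K]_n) M0 :
  cvg_entries M M0 -> cvg_entries (fun x => \adj (M x)) (\adj M0).
Proof.
move=> MM0 k l; rewrite mxE; under eq_fun do rewrite mxE.
apply: cvgM; first exact: cvg_cst.
apply: cvg_det => a b; rewrite !mxE; under eq_fun do rewrite !mxE.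
exact: MM0.
Qed.

End EntrywiseConvergence.

(** Here h is the size of the perturbation and q the difference quotient of the eigenvalue. A
    general filter allows a real parameter, avoiding 0, to drive a perturbation over the complex
    field. *)
Lemma simple_eigenvalue_slope (K : numFieldType) (T : Type) (F : set_system T)
    (FF : ProperFilter F) (d : nat) (A Delta : 'M[K]_d) (lam : 'I_d -> K)
    (j : 'I_d) (u : 'rV[K]_d) (v : 'cV[K]_d) (h q : T -> K) (q0 : K) :
    injective lam -> (forall k, eigenvalue A (lam k)) ->
    u *m A = lam j *: u -> A *m v = lam j *: v -> u *m v = 1%:M ->
    h x @[x --> F] --> (0 : K) -> (\forall x \near F, h x != 0) ->
    q x @[x --> F] --> q0 ->
    (\forall x \near F, eigenvalue (A + h x *: Delta) (lam j + h x * q x)) ->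
  q0 = (u *m Delta *m v) 0 0.
Proof.
move=> lam_inj lam_eig uA Av uv h0 h_neq0 qq0 q_eig.
set Q := invmx (A - (lam j)%:M + v *m u).
(* Chosen so that A - lam + h E = (A + h Delta) - (lam + h q), which is singular by hypothesis. *)
pose E x := Delta + q x *: (- 1%:M).
pose P x := 1%:M + (h x *: E x) *m Q.
have E_cvg : cvg_entries F E (Delta + q0 *: (- 1%:M)).
  apply: cvg_entriesD; first exact: cvg_entries_cst.
  by apply: cvg_entriesZ => //; exact: cvg_entries_cst.
have P_cvg : cvg_entries F P 1%:M.
  rewrite -[1%:M]addr0; apply: cvg_entriesD; first exact: cvg_entries_cst.
  rewrite -(mul0mx d Q) -(scale0r (Delta + q0 *: (- 1%:M))).
  by apply: cvg_entriesM; [exact: cvg_entriesZ | exact: cvg_entries_cst].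
have detP_neq0 : \forall x \near F, \det (P x) != 0.
  by apply: cvgr_neq0 (cvg_det P_cvg) _; rewrite det1 oner_eq0.
have val_cvg : (u *m \adj (P x) *m E x *m v) 0 0 @[x --> F] -->
    (u *m \adj 1%:M *m (Delta + q0 *: (- 1%:M)) *m v) 0 0.

  apply: cvg_entriesM; last exact: cvg_entries_cst.
  apply: cvg_entriesM => //; apply: cvg_entriesM; first exact: cvg_entries_cst.
  exact: cvg_entries_adj.
(* The kernel identity for B = h E is linear in the last factor B, so the nonzero h cancels. *)
have val_eq0 : \forall x \near F, (u *m \adj (P x) *m E x *m v) 0 0 = 0.
  near=> x; have hx : h x != 0 by near: x.
  have : u *m \adj (P x) *m (h x *: E x) *m v = 0.
    apply: (perturbed_kernel_adj lam_inj lam_eig uA Av uv); last by near: x.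
    rewrite -kermx_eq0.
    have -> : A - (lam j)%:M + h x *: E x =
        A + h x *: Delta - (lam j + h x * q x)%:M.
      by rewrite scalerDr scalerA scalerN scalemx1 addrACA raddfD opprD.
    by near: x.
  rewrite -scalemxAr -scalemxAl => /eqP; rewrite scaler_eq0 (negPf hx) /=.
  by move/eqP => ->; rewrite mxE.
have : (u *m \adj 1%:M *m (Delta + q0 *: (- 1%:M)) *m v) 0 0 = 0.
  apply: norm_cvg_unique val_cvg _.
  by apply: cvg_near_cst; near=> x; near: x.
(* In the limit the adjugate is the identity, and u v = 1 leaves u Delta v - q0 = 0. *)
rewrite adj1 mulmx1 scalerN scalemx1 mulmxDr mulmxDl mulmxN mul_mx_scalar mulNmx.
rewrite -scalemxAl uv !mxE => /eqP; rewrite subr_eq0 mulr1 => /eqP <-.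
by rewrite ?mxE.
Unshelve. all: by end_near.
Qed.

(** * Real first-order expansions with quadratic remainder *)

Section RealFirstOrder.
Variable R : realType.
Implicit Types (f g : R -> R) (s : R).

Lemma eq_real_first_order f g s :
    (\forall t \near (0 : R), f t = g t) ->
  real_first_order_at0 f s -> real_first_order_at0 g s.
Proof.
move=> fg [C C_ge0 fC]; exists C => //.
have fg0 := nbhs_singleton fg.
by apply: filterS2 fg fC => t; rewrite fg0 => ->.
Qed.

Lemma real_first_order_sum (I : finType) (p s_ : I -> R) (f_ : I -> R -> R) :
    (forall i, 0 <= p i) -> (forall i, real_first_order_at0 (f_ i) (s_ i)) ->
  real_first_order_at0 (fun t => \sum_i p i * f_ i t) (\sum_i p i * s_ i).
Proof.
(* One constant is chosen for each index, so that their weighted sum can serve as the witness. *)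
move=> p_ge0 /(_ _)/cid2 fs; pose C i := s2val (fs i).
exists (\sum_i p i * C i).
  by apply: sumr_ge0 => i _; rewrite mulr_ge0 // /C; case: (fs i).
have fC i : \forall t \near (0 : R),
    `|f_ i t - (f_ i 0 + t * s_ i)| <= C i * t ^+ 2.
  by rewrite /C; case: (fs i).
have fC_all : \forall t \near (0 : R), forall i,
    `|f_ i t - (f_ i 0 + t * s_ i)| <= C i * t ^+ 2.
  exact: (filter_forall _ fC).
apply: filterS fC_all => t fCt; rewrite mulr_sumr -big_split -sumrB mulr_suml.
apply: le_trans (ler_norm_sum _ _ _) _; apply: ler_sum => i _.
rewrite -mulrA (_ : _ - _ = p i * (f_ i t - (f_ i 0 + t * s_ i))) /=; last ring.
by rewrite normrM ger0_norm // ler_wpM2l.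
Qed.

Lemma real_first_order_cvg f s :
  real_first_order_at0 f s -> f t @[t --> (0 : R)] --> f 0.
Proof.
move=> [C C_ge0 fC]; apply/(@cvgrPdist_le R R) => e e_gt0.
(* For |t| <= 1 the increment of f is at most (C + |s|) |t|; the extra 1 makes the divisor
   positive. *)
have D_gt0 : 0 < C + `|s| + 1 by rewrite ltr_wpDl // addr_ge0.
near=> t; have t_le1 : `|t| <= 1 by near: t; exact: near_norm_le.
have t_le : `|t| <= e / (C + `|s| + 1).
  by near: t; apply: near_norm_le; rewrite divr_gt0.
rewrite ler_pdivlMr // in t_le.
have t2_le : C * t ^+ 2 <= C * `|t|.
  by rewrite ler_wpM2l // -[t ^+ 2]real_normK ?num_real // expr2 ler_piMl.
have ts : `|t * s| = `|t| * `|s| := normrM t s.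
have : `|f t - (f 0 + t * s)| <= C * t ^+ 2 by near: t.
have : `|f 0 - f t| <= `|f t - (f 0 + t * s)| + `|t * s|.
  rewrite (_ : f 0 - f t = - (f t - (f 0 + t * s) + t * s)); last by ring.
  by rewrite normrN ler_normD.
have := normr_ge0 t.
by lra.
Unshelve. all: by end_near.
Qed.

Lemma real_first_order_bigO f s :
  real_first_order_at0 f s ->
  (fun t => f t - (f 0 + t * s)) =O_ (0 : R) (fun t => t ^+ 2).
Proof.
move=> [C C_ge0 fC]; apply/eqO_exP; exists (C + 1); first by rewrite ltr_wpDl.
apply: filterS fC => t /le_trans; apply.
by rewrite ger0_norm ?sqr_ge0 // ler_wpM2r ?sqr_ge0 // lerDl.
Qed.

(** Passes from the logarithmic to the exponential form: the remainder in the exponent is exactly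
    the one in the logarithm. *)
Lemma mul_expR_ln_sub (x y z : R) : 0 < x -> 0 < y ->
  x = y * expR (z + (ln x - (ln y + z))).
Proof.
move=> x_gt0 y_gt0; have -> : z + (ln x - (ln y + z)) = ln x - ln y by ring.
by rewrite expRB !lnK ?posrE // mulrC divfK // gt_eqF.
Qed.

End RealFirstOrder.

(** The quotient (b t - b 0) / t differs from c1 by at most C |t|, so it tends to c1 along the
    punctured neighbourhoods of 0 and the general slope formula applies. *)
Lemma normalized_eigenvectors_slope (R : realType) (d : nat)
    (A Delta : 'M[R[i]]_d) (lam : 'I_d -> R[i]) (j : 'I_d) (u v : 'cV[R[i]]_d)
    (b : R -> R[i]) (c1 : R[i]) :
    simple_eigenvalues A lam -> normalized_eigenvectors A (lam j) u v ->
    b 0 = lam j -> first_order_at0 b c1 ->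
    (\forall t \near (0 : R), eigenvalue (A + t%:C *: Delta) (b t)) ->
  c1 = (u^t* *m Delta *m v) 0 0.
Proof.
move=> [charA lam_inj] [uA Av uv] b0 [C C_ge0 bC] b_eig.
have lam_eig k : eigenvalue A (lam k).
  rewrite eigenvalue_root_char charA rootE horner_prod (bigD1 k) //=.
  by rewrite hornerXsubC subrr mul0r.
have tC_cvg : (t%:C : R[i]) @[t --> (0 : R)^'] --> (0 : R[i]^o).
  apply/(@cvgrPdist_lt R[i] R[i]^o) => e; rewrite ltcE => /andP[/eqP /= e_im e_re].
  (* A positive element of [R[i]] has zero imaginary part, so the radius is real. *)
  have -> : e = (complex.Re e)%:C by case: e e_im {e_re} => x y /= ->.
  have := @dnbhs0_lt R R _ e_re; apply: filterS => t t_lt.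
  by rewrite sub0r normrN normr_normc normc_real ltcR.
pose q t := (b t - b 0) / t%:C.
have q_cvg : q t @[t --> (0 : R)^'] --> (c1 : R[i]^o).
  apply/(@cvgrPdist_lt R[i] R[i]^o) => e; rewrite ltcE => /andP[/eqP /= e_im e_re].
  have -> : e = (complex.Re e)%:C by case: e e_im {e_re} => x y /= ->.
  have bC' := nbhs_dnbhs bC.
  near=> t; have t_neq0 : t != 0 by near: t; exact: nbhs_dnbhs_neq.
  have tC_neq0 : t%:C != 0 :> R[i] by rewrite -normc_gt0 normc_real normr_gt0.
  have bt : normc (b t - (b 0 + t%:C * c1)) <= C * t ^+ 2 by near: t.
  have t_lt : `|t| < complex.Re e / (C + 1).
    by near: t; apply: (@dnbhs0_lt R R); rewrite divr_gt0 // ltr_wpDl.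
  rewrite distrC normr_normc ltcR.
  have -> : q t - c1 = (b t - (b 0 + t%:C * c1)) / t%:C by rewrite /q; field.
  rewrite normcM normcV normc_real ltr_pdivrMr ?normr_gt0 //.
  apply: (le_lt_trans bt); rewrite -[t ^+ 2]real_normK ?num_real // expr2 mulrA.
  rewrite ltr_pM2r ?normr_gt0 //; move: t_lt; rewrite ltr_pdivlMr ?ltr_wpDl //.
  by have := normr_ge0 t; lra.
have t_neq0 : \forall t \near (0 : R)^', t%:C != 0 :> R[i].
  apply: filterS (nbhs_dnbhs_neq (0 : R)) => t t_neq0.
  by rewrite -normc_gt0 normc_real normr_gt0.
have q_eig : \forall t \near (0 : R)^',
    eigenvalue (A + t%:C *: Delta) (lam j + t%:C * q t).
  apply: filterS2 t_neq0 (nbhs_dnbhs b_eig) => t tC_neq0.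
  suff -> : lam j + t%:C * q t = b t by [].
  by rewrite -b0 /q; field.
exact: (simple_eigenvalue_slope _ lam_inj lam_eig uA Av uv tC_cvg t_neq0 q_cvg
  q_eig).
Unshelve. all: by end_near.
Qed.

(** * Persistence of the dominant index *)

Section MaximalGrowth.
Variables (R : realType) (d m : nat) (p : 'I_m -> R).
Variables (l : 'I_m -> 'I_d -> R -> R[i]) (jstar : 'I_d).

Lemma rho_infty_dominant (t : R) :
    (forall j, j != jstar -> mu p l j t < mu p l jstar t) ->
  rho_infty p l t = expR (mu p l jstar t).
Proof.
move=> dom; apply/eqP; rewrite eq_le /rho_infty; apply/andP; split.
  (* The first goal concerns the default value 0 of the maximum. *)
  apply: bigmax_le => [|j _]; first exact: expR_ge0.
  have [-> //|/dom/ltW] := eqVneq j jstar.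
  by rewrite ler_expR.
exact: (le_bigmax 0 (fun j => expR (mu p l j t))).
Qed.

(** Each strict gap at 0 persists nearby by continuity, and finitely many neighbourhoods intersect
    in a neighbourhood. *)
Lemma dominant_near0 :
    (forall j, mu p l j t @[t --> (0 : R)] --> mu p l j 0) ->
    (forall j, j != jstar -> mu p l j 0 < mu p l jstar 0) ->
  \forall t \near (0 : R), forall j, j != jstar ->
    mu p l j t < mu p l jstar t.
Proof.
move=> mu_cvg dom.
have near_j j : \forall t \near (0 : R), j != jstar ->
    mu p l j t < mu p l jstar t.
  have [-> | jne] := eqVneq j jstar; first by near=> t.
  have gap : 0 < mu p l jstar 0 - mu p l j 0 by rewrite subr_gt0 dom.
  have gap_cvg : mu p l jstar t - mu p l j t @[t --> (0 : R)] -->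
      mu p l jstar 0 - mu p l j 0 by apply: (@cvgB R R).
  near=> t => _; rewrite -subr_gt0; near: t.
  exact: cvgr_gt gap_cvg _ gap.
exact: (filter_forall _ near_j).
Unshelve. all: by end_near.
Qed.

End MaximalGrowth.

Lemma normalized_eigenvectors_diag (R : realType) (d : nat) (D : 'rV[R[i]]_d)
    (j : 'I_d) :
  normalized_eigenvectors (diag_mx D) (D 0 j) (delta_mx j 0) (delta_mx j 0).
Proof.
rewrite /normalized_eigenvectors trmx_delta map_delta_mx; split.
- by rewrite -rowE row_diag_mx.
- by apply: trmx_inj; rewrite trmx_mul tr_diag_mx linearZ /= trmx_delta -rowE row_diag_mx.
- by rewrite mul_delta_mx; apply/matrixP => a b; rewrite !mxE !ord1.
Qed.

(** * Assembly of the expansion *)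

Theorem corollary5 (R : realType) (d m : nat)
    (A Delta : 'I_m -> 'M[R[i]]_d) (lam : 'I_m -> 'I_d -> R[i])
    (p : 'I_m -> R) (eps0 : R) (S : R -> 'M[R[i]]_d) (jstar : 'I_d)
    (Delta_norm : forall i, frobenius_norm (Delta i) = 1)
    (lam_simple : forall i, simple_eigenvalues (A i) (lam i))
    (lam_neq0 : forall i j, lam i j != 0)
    (p_ge0 : forall i, 0 <= p i)
    (p_sum1 : \sum_(i < m) p i = 1)
    (eps0_gt0 : 0 < eps0)
    (S_unit : forall eps : R, `|eps| <= eps0 -> S eps \in unitmx)
    (T_upper : forall (eps : R) i, `|eps| <= eps0 ->
      upper_triangular (triangular_form A Delta S i eps))
    (diag_neq0 : forall (eps : R) i j, `|eps| <= eps0 ->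
      diag_entry A Delta S i j eps != 0)
    (diag_at0 : forall i j, diag_entry A Delta S i j 0 = lam i j)
    (diag_branch : forall i j, exists2 b : R -> R[i],
      analytic_eigenvalue_branch (perturbed A Delta i) (lam i j) b &
      \forall eps \near (0 : R), diag_entry A Delta S i j eps = b eps)
    (dominant : forall j, j != jstar ->
      mu p (diag_entry A Delta S) j 0 < mu p (diag_entry A Delta S) jstar 0) :
  let rho := rho_infty p (diag_entry A Delta S) in
  [/\ \forall eps \near (0 : R),
        ln (rho eps) =
        \sum_(i < m) p i * ln (normc (diag_entry A Delta S i jstar eps)),
      forall u v : 'I_m -> 'cV[R[i]]_d,
        (forall i, normalized_eigenvectors (A i) (lam i jstar) (u i) (v i)) ->
        let s := first_order_coef p
          (fun i => ((u i)^t* *m Delta i *m v i) 0 0) (fun i => lam i jstar) in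
        (fun eps => ln (rho eps) - (ln (rho 0) + eps * s))
          =O_ (0 : R) (fun eps => eps ^+ 2) /\
        (exists2 r : R -> R,
          r =O_ (0 : R) (fun eps => eps ^+ 2) &
          \forall eps \near (0 : R),
            rho eps = rho 0 * expR (eps * s + r eps)) &
      (forall i, A i = diag_mx (\row_j lam i j)) ->
        (forall i, normalized_eigenvectors (A i) (lam i jstar)
          (delta_mx jstar 0) (delta_mx jstar 0)) /\
        (let s := first_order_coef p
          (fun i => Delta i jstar jstar) (fun i => lam i jstar) in
        (fun eps => ln (rho eps) - (ln (rho 0) + eps * s))
          =O_ (0 : R) (fun eps => eps ^+ 2))].
Proof.
set l := diag_entry A Delta S => rho.
(* The coefficient comes from the analytic branch alone, before any eigenvectors are given; every
   normalized pair then computes the same [c1]. *)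
have branch i j : exists c1, real_first_order_at0
      (fun t => ln (normc (l i j t))) (complex.Re (c1 / lam i j)) /\
    forall u v, normalized_eigenvectors (A i) (lam i j) u v ->
      c1 = (u^t* *m Delta i *m v) 0 0.
  have [b [b0 b_analytic b_eig] lb] := diag_branch i j.
  have [c1 b_c1] := analytic_first_order b_analytic.
  exists c1; split; last first.
    move=> u v uv.
    exact: normalized_eigenvectors_slope (lam_simple i) uv b0 b_c1 b_eig.
  rewrite -b0; apply: eq_real_first_order (ln_normc_first_order _ b_c1).
    by apply: filterS lb => t lbt; rewrite /l lbt.
  by rewrite b0.
have {branch} /choice[c branch] (ij : 'I_m * 'I_d) := branch ij.1 ij.2.
pose s j := first_order_coef p (fun i => c (i, j)) (fun i => lam i j).
have mu_expansion j : real_first_order_at0 (mu p l j) (s j).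
  by apply: real_first_order_sum => // i; exact: (branch (i, j)).1.
have rhoE : \forall t \near (0 : R), rho t = expR (mu p l jstar t).
  (* The expansions of all the [mu] provide the continuity at 0 that keeps [jstar] dominant. *)
  have := dominant_near0 (fun j => real_first_order_cvg (mu_expansion j)) dominant.
  by apply: filterS => t; exact: rho_infty_dominant.
have ln_rhoE : \forall t \near (0 : R), ln (rho t) = mu p l jstar t.
  by apply: filterS rhoE => t ->; rewrite expRK.
have expansion (u v : 'I_m -> 'cV[R[i]]_d) :
    (forall i, normalized_eigenvectors (A i) (lam i jstar) (u i) (v i)) ->
    (fun eps => ln (rho eps) - (ln (rho 0) + eps * first_order_coef p
      (fun i => ((u i)^t* *m Delta i *m v i) 0 0) (fun i => lam i jstar)))
    =O_ (0 : R) (fun eps => eps ^+ 2).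
  move=> uv.
  have <- : s jstar = first_order_coef p
      (fun i => ((u i)^t* *m Delta i *m v i) 0 0) (fun i => lam i jstar).
    by apply: eq_bigr => i _; rewrite ((branch (i, jstar)).2 _ _ (uv i)).
  apply: (@real_first_order_bigO _ (fun t => ln (rho t))).
  apply: eq_real_first_order (mu_expansion jstar).
  by apply: filterS ln_rhoE => t ->.
split=> //.
- move=> u v uv; set a := first_order_coef _ _ _.
  have bigO := expansion u v uv; split=> //.
  (* The remainder of the logarithmic expansion is reused as the one in the exponent. *)
  exists (fun eps => ln (rho eps) - (ln (rho 0) + eps * a)) => //.
  have rho0_gt0 : 0 < rho 0 by rewrite (nbhs_singleton rhoE) expR_gt0.
  apply: filterS rhoE => t rho_t.
  have rho_gt0 : 0 < rho t by rewrite rho_t expR_gt0.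
  exact: mul_expR_ln_sub.
- move=> A_diag.
  have diag_uv i : normalized_eigenvectors (A i) (lam i jstar)
      (delta_mx jstar 0) (delta_mx jstar 0).
    have := normalized_eigenvectors_diag (\row_j lam i j) jstar.
    by rewrite -A_diag mxE.
  split=> //; have := expansion _ _ diag_uv.
  rewrite (_ : first_order_coef _ _ _ = first_order_coef p
    (fun i => Delta i jstar jstar) (fun i => lam i jstar)) //.
  (* Between two copies of the basis vector at [jstar], the product selects the diagonal entry of
     [Delta i]. *)
  apply: eq_bigr => i _.
  by rewrite trmx_delta map_delta_mx -rowE -colE !mxE.
Qed.
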